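(* Let $R$ be a commutative ring with identity and let $S$ be a multiplicative subset of $R$ with $0\notin S$. The following statements are equivalent for $a\in R$: (1) $a\in S\text{-}\mathrm{vnr}(R)$. (2) There exist $s\in S$ and $u\in S\text{-}\mathrm{u}(R)$ such that $sa=a^2u$. (3) There exist $s\in S$, $u\in S\text{-}\mathrm{u}(R)$ and $e\in S\text{-}\mathrm{idem}(R)$ such that $sa=ue$. (4) There exist $s\in S$ and $b\in S\text{-}\mathrm{vnr}(R)\setminus\{a\}$ such that $sab=0$ and $sa+b\in S\text{-}\mathrm{u}(R)$. (5) There exist $s\in S$ and $b\in R$ such that $sab=0$ and $sa+b\in S\text{-}\mathrm{u}(R)$.
   Context: A multiplicative subset contains $1$ and is closed under multiplication. Notation: $S\text{-}\mathrm{u}(R)=\{a\in R: ab\in S\text{ for some } b\in R\}$ ($S$-invertible elements); $S\text{-}\mathrm{idem}(R)=\{a\in R: sa=a^2\text{ for some } s\in S\}$ ($S$-idempotent elements); $S\text{-}\mathrm{vnr}(R)=\{a\in R: sa=a^2b\text{ for some } b\in R, s\in S\}$ ($S$-von Neumann regular elements). *)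

(* Defs.v *)
From mathcomp Require Import all_boot all_algebra.
From mathcomp Require Import classical_sets.

Set Implicit Arguments.
Unset Strict Implicit.
Unset Printing Implicit Defensive.

Import GRing.Theory.
Local Open Scope ring_scope.
Local Open Scope classical_set_scope.

(* [set R] is used rather than [{pred R}], so that subsets of R are not
   required to be decidable; this is why [mulr_closed] is not used. *)
Definition multiplicative_subset (R : comPzRingType) (S : set R) : Prop :=
  S 1 /\ (forall x y : R, S x -> S y -> S (x * y)).

Definition S_unit (R : comPzRingType) (S : set R) : set R :=
  [set a | exists b : R, S (a * b)].

Definition S_idem (R : comPzRingType) (S : set R) : set R :=
  [set a | exists s : R, S s /\ s * a = a ^+ 2].

Definition S_vnr (R : comPzRingType) (S : set R) : set R :=
  [set a | exists b s : R, S s /\ s * a = a ^+ 2 * b].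

(* Main.v *)
(** If [s a = a^2 b], then [e = a b] satisfies [e^2 = s e], so [e] and [s - e]
    behave like complementary idempotents up to the scalar [s].  Combining
    something invertible on [e] with something invertible on [s - e] yields the
    [S]-units required in (2) and (4). *)

Require Import Defs.
From mathcomp Require Import all_boot all_algebra.
From mathcomp Require Import classical_sets.
From mathcomp Require Import boolp ring.

Import GRing.Theory.
Local Open Scope ring_scope.
Local Open Scope classical_set_scope.

(* On the [e]-part the product is [u v e^2 = t r e]; the factor [t] on the
   second summand of the inverse balances this to the total [t r^2]. *)
Lemma S_unit_glue (R : comPzRingType) (S : set R) (u v t e r : R) :
  multiplicative_subset S -> S t -> S r -> u * v * e = t * e ->
  r * e = e ^+ 2 -> S_unit S (u * e + (r - e)).
Proof.
move=> [_ SM] St Sr uve re; exists (v * e + t * (r - e)).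
suff -> : (u * e + (r - e)) * (v * e + t * (r - e)) = t * (r * r)
  by exact: SM St (SM _ _ Sr Sr).
have -> : (u * e + (r - e)) * (v * e + t * (r - e)) =
    (u * v * e) * e + t * (r * r) - t * (r * e)
    + (u * t + v - t) * (r * e - e ^+ 2) by ring.
rewrite uve re; ring.
Qed.

Theorem theorem2p7 (R : comPzRingType) (S : set R)
    (hS : multiplicative_subset S) (hS0 : ~ S 0) (a : R) :
  [<-> S_vnr S a;
       exists s u : R, S s /\ S_unit S u /\ s * a = a ^+ 2 * u;
       exists s u e : R, S s /\ S_unit S u /\ S_idem S e /\ s * a = u * e;
       exists s b : R, S s /\ (S_vnr S `\ a) b /\
         s * a * b = 0 /\ S_unit S (s * a + b);
       exists s b : R, S s /\ s * a * b = 0 /\ S_unit S (s * a + b)].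
Proof.
have [S1 SM] := hS.
tfae.
(* With [e = a * b], [a] inverts [b] on the [e]-part up to [s], while [a * (s - e) = 0], so the
   summand [s - e] does not affect the product with [a ^+ 2]. *)
- move=> [b [s [Ss sa]]]; exists (s * s), (b * (a * b) + (s - a * b)).
  have se : s * (a * b) = (a * b) ^+ 2 by rewrite mulrA sa; ring.
  split; first exact: SM.
  split.
    apply: (@S_unit_glue R S b a s (a * b) s) => //.
    by rewrite se; ring.
  have -> : a ^+ 2 * (b * (a * b) + (s - a * b)) =
    (a ^+ 2 * b) * (a * b) + a * (s * a) - a * (a ^+ 2 * b) by ring.
  rewrite -sa; have -> : s * a * (a * b) = s * (a ^+ 2 * b) by ring.
  by rewrite -sa; ring.
(* The scalar [s] only witnesses that [a * u] is [S]-idempotent. *)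
- move=> [s [u [Ss [[v Suv] sa]]]]; exists (u * v), v, (a * u).
  split=> //; split; first by exists u; rewrite mulrC.
  split; last by ring.
  by exists s; split=> //; rewrite mulrA sa; ring.
- move=> [s [u [e [Ss [[v Suv] [[r [Sr re]] sa]]]]]].
  have sab : s * a * (r - e) = 0.
    have -> : s * a * (r - e) = u * (r * e - e ^+ 2) by rewrite sa; ring.
    by rewrite re; ring.
  have rb : r * (r - e) = (r - e) ^+ 2 * 1.
    have -> : (r - e) ^+ 2 * 1 = r * (r - e) - (r * e - e ^+ 2) by ring.
    by rewrite re; ring.
  have [ba|ba] := pselect (r - e = a); last first.
    (* The complement of [e] works, as [s * a + (r - e) = u * e + (r - e)]. *)
    exists s, (r - e); split=> //; split.
      by split=> //; exists 1, r.
    by split=> //; rewrite sa; apply: (@S_unit_glue R S u v (u * v)).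
  (* If [a = r - e] then [s r a = s a^2 = 0], so [b = 1] works instead. *)
  have sra : s * r * a = 0.
    rewrite ba in rb sab.
    by rewrite -mulrA rb mulr1 expr2 mulrA.
  exists (s * r), 1; split; first exact: SM.
  split.
    split; first by exists 1, 1; split=> //; ring.
    (* [a = 1] would force [s * r = 0]. *)
    move=> /= a1; apply: hS0; rewrite -sra -a1 mulr1; exact: SM.
  by rewrite sra mul0r add0r; split=> //; exists 1; rewrite mulr1.
- by move=> [s [b [Ss [_ [sab Su]]]]]; exists s, b.
- move=> [s [b [Ss [sab [c St]]]]].
  (* Multiplying [(s * a + b) * c] by [s * a] kills the [b]-term and leaves a multiple of
     [a ^+ 2]. *)
  exists (s ^+ 2 * c), ((s * a + b) * c * s); split; first exact: SM.
  have -> : (s * a + b) * c * s * a = a ^+ 2 * (s ^+ 2 * c) + s * a * b * c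
    by ring.
  by rewrite sab mul0r addr0.
Qed.
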